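(* Let $X$ be a set equipped with a metric topology, and let $K : X \times X \to \mathbb{C}$ be a continuous kernel function corresponding to a reproducing kernel Hilbert space (RKHS) $H$ over $X$. Let $V \in H$, let $D \subset X$ be compact, let $r > 0$, and suppose that $\|V\|_{r,x}$ is continuous with respect to $x$. Then for every $\epsilon > 0$ there is an $M \in \mathbb{N}$ such that for each $x \in D$ there are centers $c_1, c_2, \dots, c_M \in N_r(x)$ and weights $w_1, \dots, w_M \in \mathbb{C}$ such that $$\left\| V(\cdot) - \sum_{i=1}^M w_i K(\cdot, c_i) \right\|_{r,x} < \epsilon.$$
   Context: $N_r(x)$ denotes the open ball of radius $r$ centered at $x$ in the metric of $X$. For $x \in X$ and $r>0$, $\|\cdot\|_{r,x}$ denotes the norm of the RKHS over $N_r(x)$ obtained by restricting the functions in $H$ to $N_r(x)$ (i.e. the RKHS whose kernel is the restriction of $K$ to $N_r(x) \times N_r(x)$); for $f \in H$, $\|f\|_{r,x}$ means the norm of $f|_{N_r(x)}$ in this space. *)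

(* Defs.v *)
From HB Require Import structures.
From mathcomp Require Import all_boot all_order all_algebra.
From mathcomp Require Import all_classical all_reals all_analysis.
From mathcomp Require Import complex.

Set Implicit Arguments.
Unset Strict Implicit.
Unset Printing Implicit Defensive.

Import Order.TTheory GRing.Theory Num.Theory.
Import numFieldNormedType.Exports.

Local Open Scope classical_set_scope.
Local Open Scope ring_scope.
Local Open Scope complex_scope.

Definition ip_norm (R : realType) (T : Type)
    (ip : (T -> R[i]) -> (T -> R[i]) -> R[i]) (f : T -> R[i]) : R :=
  Num.sqrt (complex.Re (ip f f)).

(* A complex Hilbert space whose vectors are functions on T.  The inner product
   is a total Rocq function, but it is constrained only on the carrier; it is
   linear in its first argument.  [0 < z] in R[i] means that z is real and
   positive. *)
Record hilbert_fun (R : realType) (T : Type) := HilbertFun {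
  hcarrier : set (T -> R[i]) ;
  hip : (T -> R[i]) -> (T -> R[i]) -> R[i] ;
  hcarrier0 : hcarrier (fun=> 0) ;
  hcarrierP : forall (a : R[i]) (f g : T -> R[i]), hcarrier f -> hcarrier g ->
    hcarrier (fun t => a * f t + g t) ;
  hip_linear : forall (a : R[i]) (f g h : T -> R[i]),
    hcarrier f -> hcarrier g -> hcarrier h ->
    hip (fun t => a * f t + g t) h = a * hip f h + hip g h ;
  hip_conj : forall f g : T -> R[i], hcarrier f -> hcarrier g ->
    hip g f = (hip f g)^* ;
  hip_gt0 : forall f : T -> R[i], hcarrier f -> f <> (fun=> 0) ->
    0 < hip f f ;
  hcomplete : forall u : nat -> T -> R[i], (forall n, hcarrier (u n)) ->
    (forall e : R, 0 < e -> exists N : nat, forall m n : nat,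
       (N <= m)%N -> (N <= n)%N ->
       ip_norm hip (fun t => u m t - u n t) < e) ->
    exists2 f : T -> R[i], hcarrier f &
      ip_norm hip (fun t => u n t - f t) @[n --> \oo] --> (0 : R)
}.

Definition hnorm (R : realType) (T : Type) (H : hilbert_fun R T)
    (f : T -> R[i]) : R :=
  ip_norm (hip H) f.

(* H is the RKHS with kernel k.  Continuity of the evaluation functionals and
   positive definiteness of k follow from this, and k determines both the
   carrier of H and its inner product on that carrier. *)
Definition reproducing_kernel (R : realType) (T : Type) (H : hilbert_fun R T)
    (k : T -> T -> R[i]) : Prop :=
  (forall t, hcarrier H (k ^~ t)) /\
  (forall f t, hcarrier H f -> hip H f (k ^~ t) = f t).

Definition restr_kernel (R : realType) (T : Type) (A : set T)
    (k : T -> T -> R[i]) : A -> A -> R[i] :=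
  fun s t => k (val s) (val t).

(* Main.v *)
(** For centers in the ball [ball x r], the reproducing property gives
[||V - \sum w_i K(., c_i)||^2 = ||V||^2 - q] in the norm of [Hr x], where [q]
depends only on the weights, the centers and the values of [V] and [K] at the
centers. Hence a combination that is good at [x] stays good at every nearby
[y], as long as the centers stay in [ball y r], because [||V||_{r,y}] is
continuous in [y]; compactness of [D] then bounds the number of centers, and
shorter combinations are padded with zero weights.

A good combination at a single point is obtained by minimizing [||V - s||] in
[H] over combinations [s] with centers in the ball. By the parallelogram law a
minimizing sequence is Cauchy, also in [Hr x] since both norms agree on such
combinations; minimality makes [V - s] asymptotically orthogonal to [K(., c)]
for [c] in the ball, so [s] converges pointwise to [V] there. Its limit in
[Hr x] is therefore the restriction of [V], which in particular lies in
[Hr x]. *)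

Require Import Defs.
From HB Require Import structures.
From mathcomp Require Import all_boot all_order all_algebra.
From mathcomp Require Import all_classical all_reals all_analysis.
From mathcomp Require Import complex.
From mathcomp Require Import ring lra.

Set Implicit Arguments.
Unset Strict Implicit.
Unset Printing Implicit Defensive.

Import Order.TTheory GRing.Theory Num.Theory.
Import numFieldNormedType.Exports.

Local Open Scope classical_set_scope.
Local Open Scope ring_scope.
Local Open Scope complex_scope.



(** * Squared norms in a Hilbert space of functions *)

Section HilbertFunctions.
Context (R : realType) (T : Type) (G : hilbert_fun R T).
Implicit Types (f g : T -> R[i]) (a : R[i]).

Definition sqnorm f : R := complex.Re (hip G f f).

Lemma hcarrierB f g : hcarrier G f -> hcarrier G g ->
  hcarrier G (fun t => f t - g t).
Proof.
move=> Gf Gg; have := hcarrierP (-1) Gg Gf.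
by congr hcarrier; apply/funext => t; ring.
Qed.

Lemma hip_self_real f : hcarrier G f -> hip G f f = (sqnorm f)%:C.
Proof.
move=> Gf; have := hip_conj Gf Gf; rewrite /sqnorm.
case: (hip G f f) => x y /= /eqP; rewrite eq_complex /= => /andP[_ /eqP yN].
by congr (_ +i* _); lra.
Qed.

Lemma sqnormD a f g : hcarrier G f -> hcarrier G g ->
  sqnorm (fun t => a * f t + g t) =
  (complex.Re a ^+ 2 + complex.Im a ^+ 2) * sqnorm f
  + 2 * complex.Re (a * hip G f g) + sqnorm g.
Proof.
move=> Gf Gg; have Gafg := hcarrierP a Gf Gg.
rewrite {1}/sqnorm hip_linear// (hip_conj Gafg Gf) (hip_conj Gafg Gg).
rewrite !hip_linear// (hip_conj Gf Gg) !hip_self_real//.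
by case: a (hip G f g) {Gafg} => [x y] [u v] /=; ring.
Qed.

Lemma sqnorm_ge0 f : hcarrier G f -> 0 <= sqnorm f.
Proof.
move=> Gf; have [->|f0] := pselect (f = fun=> 0).
  (* [hip_gt0] is silent at zero; there, linearity with [a = -1] gives
     [hip 0 0 = - hip 0 0 + hip 0 0]. *)
  have := hip_linear (-1) (hcarrier0 G) (hcarrier0 G) (hcarrier0 G).
  have -> : (fun=> -1 * 0 + 0) = (fun=> 0) :> (T -> R[i]).
    by apply/funext => t; rewrite mulr0 addr0.
  by rewrite /sqnorm => ->; rewrite mulN1r addNr.
by have := hip_gt0 Gf f0; rewrite ltcE => /andP[_ /ltW].
Qed.

Lemma sqnormB f g : hcarrier G f -> hcarrier G g ->
  sqnorm (fun t => f t - g t) =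
  sqnorm f - 2 * complex.Re (hip G f g) + sqnorm g.
Proof.
move=> Gf Gg; rewrite (_ : (fun t => _) = fun t => -1 * g t + f t); last first.
  by apply/funext => t; ring.
rewrite sqnormD// (hip_conj Gf Gg).
by case: (hip G f g) => u v /=; ring.
Qed.

Lemma sqnormBC f g : hcarrier G f -> hcarrier G g ->
  sqnorm (fun t => f t - g t) = sqnorm (fun t => g t - f t).
Proof.
move=> Gf Gg; rewrite !sqnormB// (hip_conj Gf Gg).
by case: (hip G f g) => u v /=; ring.
Qed.

Lemma sqnormZ a f : hcarrier G f ->
  sqnorm (fun t => a * f t) =
  (complex.Re a ^+ 2 + complex.Im a ^+ 2) * sqnorm f.
Proof.
move=> Gf.
have -> : (fun t => a * f t) = fun t => (a - 1) * f t + f t.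
  by apply/funext => t; ring.
by rewrite sqnormD// hip_self_real//; case: a => x y /=; ring.
Qed.

(** The usual law for [h - g] and [h - f]: their difference is [f - g], and their sum is twice the
    difference of [h] and the midpoint of [f] and [g]. In this form, distances to [h] control
    [f - g]. *)
Lemma parallelogram f g h : hcarrier G f -> hcarrier G g -> hcarrier G h ->
  sqnorm (fun t => f t - g t) =
  2 * sqnorm (fun t => h t - f t) + 2 * sqnorm (fun t => h t - g t)
  - 4 * sqnorm (fun t => h t - 2^-1 * (f t + g t)).
Proof.
move=> Gf Gg Gh; have Gu := hcarrierB Gh Gf; have Gv := hcarrierB Gh Gg.
set u := (fun t => h t - f t) in Gu *; set v := (fun t => h t - g t) in Gv *.
have -> : (fun t => f t - g t) = fun t => v t - u t.
  by apply/funext => t; rewrite /u /v; ring.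
have -> : (fun t => h t - 2^-1 * (f t + g t)) =
    fun t => (2^-1)%:C * (1 * v t + u t).
  by apply/funext => t; rewrite /u /v /= fmorphV rmorph_nat; field.
rewrite (sqnormZ _ (hcarrierP 1 Gv Gu)).
rewrite sqnormB// sqnormD//=.
by case: (hip G v u) => x y /=; field.
Qed.

Lemma hnorm_lt f (e : R) : hcarrier G f -> 0 < e ->
  (hnorm G f < e) = (sqnorm f < e ^+ 2).
Proof.
move=> Gf e0; rewrite /hnorm /ip_norm -/(sqnorm f).
rewrite -{1}(gtr0_norm e0) -sqrtr_sqr.
by rewrite ltr_sqrt// exprn_gt0.
Qed.

Lemma sqr_hnorm f : hcarrier G f -> hnorm G f ^+ 2 = sqnorm f.
Proof. by move=> Gf; rewrite /hnorm /ip_norm sqr_sqrtr//; apply: sqnorm_ge0. Qed.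

(* Test the hypothesis at [a = - f t / (k t t + 1)]. *)
Lemma eval_bound (k : T -> T -> R[i]) f t (d : R) :
  reproducing_kernel G k -> hcarrier G f ->
  (forall a, sqnorm f - d <= sqnorm (fun u => a * k u t + f u)) ->
  complex.Re (f t) ^+ 2 + complex.Im (f t) ^+ 2 <=
  d * (complex.Re (k t t) + 1).
Proof.
move=> [kG kE] Gf le_d; set c := complex.Re (k t t).
have cE : sqnorm (k ^~ t) = c by rewrite /sqnorm kE.
have c0 : 0 <= c by rewrite -cE; apply: sqnorm_ge0; apply: kG.
have := le_d (- ((c + 1)^-1%:C * f t)); rewrite sqnormD//.
rewrite (hip_conj Gf (kG t)) kE// cE; case: (f t) => x y /= le.
(* At this [a] the squared norm drops by [|f t|^2 (c + 2) / (c + 1)^2]; the [+ 1] keeps the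
   denominator positive when [c = 0]. *)
have {}le : (x ^+ 2 + y ^+ 2) * (c + 2) / (c + 1) ^+ 2 <= d.
  rewrite -subr_ge0; move: le; rewrite -subr_ge0 => /le_trans; apply.
  rewrite le_eqVlt; apply/orP; left; apply/eqP; field.
  by rewrite gt_eqF// ltr_wpDl.
rewrite ler_pdivrMr ?exprn_gt0 ?ltr_wpDl// in le.
have : (x ^+ 2 + y ^+ 2) * (c + 1) <= d * (c + 1) * (c + 1).
  rewrite -mulrA -expr2; apply: le_trans le.
  by rewrite ler_wpM2l ?addr_ge0 ?sqr_ge0//; lra.
by rewrite ler_pM2r// ltr_wpDl.
Qed.

End HilbertFunctions.

(** * Finite kernel combinations *)

Section KernelCombinations.
Context (R : realType) (T : choiceType) (K : T -> T -> R[i]).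
Implicit Types (f : T -> R[i]) (s : seq (R[i] * T)).

(** Lists of weight-center pairs, so that concatenating and scaling lists realize the vector
    operations. *)
Definition kcomb s : T -> R[i] := fun y => \sum_(p <- s) p.1 * K y p.2.

Definition kscale (a : R[i]) s := [seq (a * p.1, p.2) | p <- s].

Lemma kcomb_nil : kcomb [::] = fun=> 0.
Proof. by apply/funext => y; rewrite /kcomb big_nil. Qed.

Lemma kcomb_cons p s : kcomb (p :: s) = fun y => p.1 * K y p.2 + kcomb s y.
Proof. by apply/funext => y; rewrite /kcomb big_cons. Qed.

Lemma kcomb_cat s s' : kcomb (s ++ s') = fun y => kcomb s y + kcomb s' y.
Proof. by apply/funext => y; rewrite /kcomb big_cat. Qed.

Lemma kcomb_scale a s : kcomb (kscale a s) = fun y => a * kcomb s y.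
Proof.
apply/funext => y; rewrite /kcomb big_map mulr_sumr.
by apply: eq_bigr => p _; rewrite mulrA.
Qed.

(* The drop in squared norm when [kcomb s] is subtracted from [f]; it does not
   mention any Hilbert space. *)
Definition knorm_drop f s : R :=
  complex.Re (\sum_(p <- s) p.1^* * (2 * f p.2 - kcomb s p.2)).

(* Used with [e] the inclusion of a ball, and with [e = id]. *)
Section PullBack.
Context (S : Type) (e : S -> T) (G : hilbert_fun R S).
Hypothesis GK : reproducing_kernel G (fun a b => K (e a) (e b)).

Definition centered_in s := {in s, forall p, range e p.2}.

Lemma centered_cons p s : centered_in (p :: s) -> range e p.2 /\ centered_in s.
Proof.
move=> ps; split; first exact/ps/mem_head.
by move=> q qs; apply: ps; rewrite inE qs orbT.
Qed.

Lemma centered_cat s s' :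
  centered_in s -> centered_in s' -> centered_in (s ++ s').
Proof. by move=> cs cs' p; rewrite mem_cat => /orP[/cs|/cs']. Qed.

Lemma centered_scale a s : centered_in s -> centered_in (kscale a s).
Proof. by move=> cs _ /mapP[p /cs ? ->]. Qed.

Lemma hcarrier_kcomb s : centered_in s -> hcarrier G (kcomb s \o e).
Proof.
elim: s => [_|p s IHs].
  by rewrite kcomb_nil; exact: hcarrier0.
move=> /centered_cons[[a _ ea] /IHs Gs]; rewrite kcomb_cons -ea.
exact: (hcarrierP p.1 (GK.1 a) Gs).
Qed.

(** Reproducing property and conjugate linearity in the second argument. The right side does not
    involve [G], so inner products of combinations do not depend on the space. *)
Lemma hip_kcomb f s : hcarrier G (f \o e) -> centered_in s ->
  hip G (f \o e) (kcomb s \o e) = \sum_(p <- s) p.1^* * f p.2.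
Proof.
move=> Gf cs; elim: s cs => [_|p s IHs].
  rewrite big_nil kcomb_nil.
  have := hip_linear (-1) (hcarrier0 G) (hcarrier0 G) Gf.
  rewrite (_ : (fun=> _) = fun=> 0 : R[i]); last first.
    by apply/funext => t; rewrite mulr0 addr0.
  rewrite mulN1r addNr => f0.
  by rewrite (hip_conj (hcarrier0 G) Gf) f0 conjc0.
move=> /centered_cons[[a _ ea] cs]; rewrite big_cons -IHs// kcomb_cons -ea.
have Ga := GK.1 a; have Gs := hcarrier_kcomb cs.
rewrite (hip_conj (hcarrierP p.1 Ga Gs) Gf) hip_linear// rmorphD rmorphM/=.
by rewrite -!hip_conj// GK.2.
Qed.

(** Expand the square: by [hip_kcomb] the cross term and the norm of the combination are finite sums
    over the centers. *)
Lemma sqnormB_kcomb f s : hcarrier G (f \o e) -> centered_in s ->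
  sqnorm G (fun t => f (e t) - kcomb s (e t)) =
  sqnorm G (f \o e) - knorm_drop f s.
Proof.
move=> Gf cs; have Gs := hcarrier_kcomb cs.
rewrite (sqnormB Gf Gs) {2}/sqnorm !hip_kcomb// /knorm_drop.
have -> : \sum_(p <- s) p.1^* * (2 * f p.2 - kcomb s p.2) =
   (2 : R)%:C * (\sum_(p <- s) p.1^* * f p.2) - \sum_(p <- s) p.1^* * kcomb s p.2.
  rewrite mulr_sumr -sumrB; apply: eq_bigr => p _.
  by rewrite rmorph_nat; ring.
case: (\sum_(p <- s) p.1^* * f p.2) => x y.
by case: (\sum_(p <- s) _) => u v /=; ring.
Qed.

End PullBack.
End KernelCombinations.

(** * Approximation on the pull-back along [e] *)

Lemma pullback_approx (R : realType) (T : choiceType) (K : T -> T -> R[i])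
    (H : hilbert_fun R T) (S : Type) (e : S -> T) (G : hilbert_fun R S)
    (V : T -> R[i]) :
  reproducing_kernel H K ->
  reproducing_kernel G (fun a b => K (e a) (e b)) ->
  hcarrier H V ->
  hcarrier G (V \o e) /\
  forall eta : R, 0 < eta -> exists2 s, centered_in e s &
    sqnorm G (fun t => V (e t) - kcomb K s (e t)) < eta.
Proof.
move=> HK GK HV.
have csid (s : seq (R[i] * T)) : centered_in (id : T -> T) s.
  by move=> p _; exists p.2.
have Hs s : hcarrier H (kcomb K s).
  exact: (hcarrier_kcomb (e := id) HK (csid s)).
have sqnormHG s : centered_in e s ->
    sqnorm G (kcomb K s \o e) = sqnorm H (kcomb K s).
  move=> cs; rewrite /sqnorm (hip_kcomb GK (hcarrier_kcomb GK cs) cs).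
  by rewrite -(hip_kcomb (e := id) HK (Hs s) (csid s)).
(* Distances are taken in [H] because [V \o e] is not yet known to lie in [G]. *)
pose dist2 s := sqnorm H (fun y => V y - kcomb K s y).
pose E := [set dist2 s | s in centered_in e].
have E_inf : has_inf E.
  split; first by exists (dist2 [::]), [::].
  by exists 0 => _ [s _ <-]; apply: sqnorm_ge0; apply: hcarrierB.
have inf_le s : centered_in e s -> inf E <= dist2 s.
  by move=> cs; apply: (ge_inf E_inf.2); exists s.
have /choice[s_ s_P] (n : nat) : exists s : seq (R[i] * T),
    centered_in e s /\ dist2 s < inf E + n.+1%:R^-1.
  have n0 : 0 < n.+1%:R^-1 :> R by rewrite invr_gt0.
  by have [_ [s cs <-] lt] := inf_adherent n0 E_inf; exists s.
pose u n := kcomb K (s_ n) \o e.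
have Gu n : hcarrier G (u n) := hcarrier_kcomb GK (s_P n).1.
have inv_lt (d : R) : 0 < d -> exists N, forall n, (N <= n)%N -> n.+1%:R^-1 < d.
  move=> d0; have := near_infty_natSinv_lt (PosNum d0).
  by case=> N _ NP; exists N => n Nn; apply: NP.
(* Parallelogram law with [h = V]: the midpoint of two combinations is again admissible, so its
   squared distance is at least [inf E] and the infima cancel. *)
have sqnormB_u m n :
    sqnorm G (fun t => u m t - u n t) <= 2 * (m.+1%:R^-1 + n.+1%:R^-1).
  have cmn : centered_in e (s_ m ++ kscale (-1) (s_ n)).
    by apply: centered_cat (s_P m).1 _; apply: centered_scale (s_P n).1.
  have cmid : centered_in e (kscale 2^-1 (s_ m ++ s_ n)).
    by apply/centered_scale/centered_cat; [exact: (s_P m).1|exact: (s_P n).1].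
  have -> : (fun t => u m t - u n t) =
      kcomb K (s_ m ++ kscale (-1) (s_ n)) \o e.
    by apply/funext => t; rewrite kcomb_cat kcomb_scale /u /=; ring.
  rewrite sqnormHG// kcomb_cat kcomb_scale.
  have -> : (fun y => kcomb K (s_ m) y + -1 * kcomb K (s_ n) y) =
      fun y => kcomb K (s_ m) y - kcomb K (s_ n) y.
    by apply/funext => y; ring.
  rewrite (parallelogram (Hs _) (Hs _) HV).
  have := inf_le _ cmid; rewrite /dist2 kcomb_scale kcomb_cat /=.
  have := (s_P m).2; have := (s_P n).2; rewrite /dist2.
  by move: n.+1%:R^-1 m.+1%:R^-1 => p q; lra.
have [phi Gphi u_phi] : exists2 f, hcarrier G f &
    ip_norm (hip G) (fun t => u n t - f t) @[n --> \oo] --> (0 : R).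
  apply: hcomplete => // d d0.
  (* Two errors below [d ^+ 2 / 4], added and doubled in [sqnormB_u], stay below [d ^+ 2]. *)
  have d20 : 0 < d ^+ 2 / 4 by rewrite divr_gt0 ?exprn_gt0.
  have [N NP] := inv_lt _ d20; exists N => m n Nm Nn.
  rewrite -/(hnorm G _) hnorm_lt ?hcarrierB//; last exact: hcarrierB.
  have := NP _ Nm; have := NP _ Nn; have := sqnormB_u m n.
  by move: n.+1%:R^-1 m.+1%:R^-1 => p q; lra.
have u_near (d : R) : 0 < d -> exists n,
    n.+1%:R^-1 < d /\ sqnorm G (fun t => u n t - phi t) < d.
  move=> d0; have sd0 : 0 < Num.sqrt d by rewrite sqrtr_gt0.
  have [N NP] := inv_lt _ d0.
  have /cvgrPdist_lt/(_ _ sd0)[N' _ N'P] := u_phi.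
  exists (maxn N N'); split; first exact/NP/leq_maxl.
  have /= := N'P (maxn N N') (leq_maxr _ _).
  rewrite sub0r normrN => /(le_lt_trans (ler_norm _)).
  rewrite -/(hnorm G _) hnorm_lt//; last exact: hcarrierB.
  by rewrite sqr_sqrtr// ltW.
(* [phi t] and [V (e t)] are both close to [u n t]: the former by convergence in [G], the latter by
   near-minimality of [s_ n] in [H]. *)
have phiE : phi = V \o e.
  apply/funext => t; set z := phi t; set v := (V \o e) t.
  pose c := complex.Re (K (e t) (e t)) + 1.
  have c0 : 0 < c.
    rewrite ltr_wpDl// (_ : complex.Re _ = sqnorm H (K ^~ (e t))); last first.
      by rewrite /sqnorm HK.2//; apply: HK.1.
    by apply: sqnorm_ge0; apply: HK.1.
  pose m := complex.Re (z - v) ^+ 2 + complex.Im (z - v) ^+ 2.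
  have m_ge0 : 0 <= m by rewrite addr_ge0// sqr_ge0.
  have [m0|m0] := eqVneq m 0.
    move: m0 => /eqP; rewrite paddr_eq0 ?sqr_ge0// !sqrf_eq0 => /andP[r0 i0].
    by apply/eqP; rewrite -subr_eq0 eq_complex r0 i0.
  (* [eval_bound] costs a factor [c], so this threshold puts [u n t] at distance less than
     [|z - v| / 2] from both [z] and [v], which is impossible. *)
  have mc0 : 0 < m / (4 * c) by rewrite divr_gt0 ?mulr_gt0// lt_neqAle eq_sym m0.
  have [n [n_lt u_lt]] := u_near _ mc0.
  have Guphi := hcarrierB (Gu n) Gphi; have HB := hcarrierB HV (Hs (s_ n)).
  have /(eval_bound (t := t) GK Guphi) : forall a : R[i],
      sqnorm G (fun t => u n t - phi t) - sqnorm G (fun t => u n t - phi t) <=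
      sqnorm G (fun b => a * K (e b) (e t) + (u n b - phi b)).
    by move=> a; rewrite subrr; apply/sqnorm_ge0/hcarrierP => //; apply: GK.1.
  have /(eval_bound (t := e t) HK HB) : forall a : R[i],
      dist2 (s_ n) - n.+1%:R^-1 <=
      sqnorm H (fun y => a * K y (e t) + (V y - kcomb K (s_ n) y)).
    (* The weight is [- a] because the combination is subtracted from [V]; the new center [e t] is
       admissible, so [inf E] is still a lower bound. *)
    move=> a; have cc : centered_in e ((- a, e t) :: s_ n).
      by move=> p; rewrite inE => /predU1P[->/=|/(s_P n).1//]; exists t.
    have := inf_le _ cc; rewrite /dist2 kcomb_cons/=.
    rewrite (_ : (fun y => V y - _) =
      fun y => a * K y (e t) + (V y - kcomb K (s_ n) y)); last first.
      by apply/funext => y; ring.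
    by have := (s_P n).2; rewrite /dist2; move: n.+1%:R^-1 => p; lra.
  rewrite -/c; rewrite -[kcomb K (s_ n) (e t)]/(u n t) -[V (e t)]/v -/z => le1 le2.
  have lt1 := ltr_pM2r c0 n.+1%:R^-1 (m / (4 * c)); rewrite n_lt in lt1.
  have lt2 := ltr_pM2r c0 (sqnorm G (fun t => u n t - phi t)) (m / (4 * c)).
  rewrite u_lt in lt2.
  have mE : m / (4 * c) * c = m / 4 by field; rewrite gt_eqF.
  rewrite mE in lt1 lt2; move: le1 le2 => /le_lt_trans/(_ lt1) + /le_lt_trans/(_ lt2).
  rewrite /m; move: (u n t) => w.
  (* The contradiction is [|z - v|^2 + |z + v - 2 w|^2 = 2 |z - w|^2 + 2 |v - w|^2 < m]. *)
  have := sqr_ge0 (complex.Re z + complex.Re v - 2 * complex.Re w).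
  have := sqr_ge0 (complex.Im z + complex.Im v - 2 * complex.Im w).
  by rewrite !raddfB/= => *; exfalso; nra.
split=> [|eta eta0]; first by rewrite -phiE.
have [n [_ u_lt]] := u_near _ eta0; exists (s_ n); first exact: (s_P n).1.
by move: u_lt; rewrite (sqnormBC (Gu n) Gphi) phiE.
Qed.

(** * From one ball to a compact set of centers *)

Lemma kcomb_pad (R : realType) (T : choiceType) (K : T -> T -> R[i]) (x : T)
    (s : seq (R[i] * T)) (M : nat) (y : T) : (size s <= M)%N ->
  kcomb K s y =
  \sum_(i < M) (nth (0, x) s i).1 * K y (nth (0, x) s i).2.
Proof.
move=> sM; rewrite /kcomb (big_nth (0, x)).
rewrite -(big_mkord xpredT (fun i => (nth (0, x) s i).1 * K y (nth (0, x) s i).2)).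
rewrite (big_cat_nat _ sM)//= [X in _ = _ + X]big1_seq ?addr0// => i.
by rewrite mem_index_iota => /andP[_ /andP[si _]]; rewrite nth_default//= mul0r.
Qed.

(** Each center leaves a slack [r - mdist x p.2] within which [x] may move, and finitely many such
    conditions hold together near [x]. *)
Lemma near_ball_centers (R : realType) (X : metricType R) (x : X) (r : R)
    (s : seq (R[i] * X)) :
  {in s, forall p, ball x r p.2} ->
  \forall y \near x, {in s, forall p, ball y r p.2}.
Proof.
elim: s => [_|p s IHs bs]; first exact: nearW.
have near_s : \forall y \near x, {in s, forall q, ball y r q.2}.
  by apply: IHs => q qs; apply: bs; rewrite inE qs orbT.
have bp : ball x r p.2 by apply: bs; exact: mem_head.
have near_p : \forall y \near x, ball y r p.2.
  move: bp; rewrite ballEmdist /= => bp.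
  have d0 : 0 < r - mdist x p.2 by rewrite subr_gt0.
  near=> y; rewrite ballEmdist/=.
  apply: (le_lt_trans (metric_triangle y x p.2)).
  rewrite -ltrBrDr metric_sym.
  have : ball x (r - mdist x p.2) y by near: y; apply: nbhsx_ballx.
  by rewrite ballEmdist.
by apply: filterS2 near_s near_p => y sy py q; rewrite inE => /predU1P[->|/sy].
Unshelve. all: by end_near. Qed.

Theorem theorem3p1 (R : realType) (X : metricType R) (K : X -> X -> R[i])
    (H : hilbert_fun R X) (HK : reproducing_kernel H K)
    (K_cont : continuous (fun p : X * X => K p.1 p.2 : R[i]^o))
    (V : X -> R[i]) (HV : hcarrier H V)
    (D : set X) (D_compact : compact D)
    (r : R) (r_gt0 : 0 < r)
    (Hr : forall x : X, hilbert_fun R (ball x r : set X))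
    (HrK : forall x : X,
      reproducing_kernel (Hr x) (restr_kernel (A := ball x r) K))
    (V_cont : continuous (fun x : X => hnorm (Hr x) (sigL (ball x r) V) : R)) :
  forall eps : R, 0 < eps ->
  exists M : nat, forall x : X, D x ->
  exists (c : 'I_M -> X) (w : 'I_M -> R[i]),
    (forall i, ball x r (c i)) /\
    hnorm (Hr x)
      (sigL (ball x r) (fun y => V y - \sum_(i < M) w i * K y (c i))) < eps.
Proof.
move=> eps eps0.
have approx x := pullback_approx HK (HrK x) HV.
(* On the right only the norm of [V] varies with [x], and it does so continuously; the drop is fixed
   once [s] is. *)
have hnorm_ltE x (s : seq (R[i] * X)) : {in s, forall p, ball x r p.2} ->
    hnorm (Hr x) (sigL (ball x r) (fun y => V y - kcomb K s y)) < eps <->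
    hnorm (Hr x) (sigL (ball x r) V) ^+ 2 < eps ^+ 2 + knorm_drop K V s.
  move=> bs; have cs : centered_in (set_val : (ball x r : set X) -> X) s.
    by move=> p /bs bp; exists (SigSub (mem_set bp)).
  have Gs := hcarrier_kcomb (HrK x) cs.
  rewrite hnorm_lt//; last exact: hcarrierB (approx x).1 Gs.
  rewrite sqr_hnorm; last exact: (approx x).1.
  by rewrite (sqnormB_kcomb (HrK x) (approx x).1 cs) ltrBlDr.
(* Compactness in near-covering form, with [M] tending to infinity, turns local length bounds into
   one bound on all of [D]. *)
have [M _ MP] : \forall M \near \oo, D `<=` (fun x =>
    exists s : seq (R[i] * X), [/\ (size s <= M)%N,
      {in s, forall p, ball x r p.2} &
      hnorm (Hr x) (sigL (ball x r) (fun y => V y - kcomb K s y)) < eps]).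
  move/compact_near_coveringP: D_compact; apply => x _.
  have [_ /(_ (eps ^+ 2))[|s cs lt_eps]] := approx x; first exact: exprn_gt0.
  have bs : {in s, forall p, ball x r p.2}.
    by move=> p /cs[a _ <-]; apply/set_mem/valP.
  have {lt_eps} lt_eps : hnorm (Hr x) (sigL (ball x r) V) ^+ 2 <
      eps ^+ 2 + knorm_drop K V s.
    apply/hnorm_ltE => //; rewrite hnorm_lt//.
    exact: hcarrierB (approx x).1 (hcarrier_kcomb (HrK x) cs).
  have V2_cont : hnorm (Hr y) (sigL (ball y r) V) ^+ 2 @[y --> x] -->
      hnorm (Hr x) (sigL (ball x r) V) ^+ 2.
    by under eq_fun do rewrite expr2; rewrite expr2; apply: cvgM; apply: V_cont.
  have near_lt := @cvgr_lt _ _ _ (nbhs_filter x) _ _ V2_cont _ lt_eps.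
  (* The list [s] found at [x] serves every [y] in this neighbourhood. *)
  exists ([set y | {in s, forall p, ball y r p.2} /\
      hnorm (Hr y) (sigL (ball y r) V) ^+ 2 < eps ^+ 2 + knorm_drop K V s],
      [set M | (size s <= M)%N]) => /=.
    split; last exact: nbhs_infty_ge.
    by apply: filterS2 (near_ball_centers bs) near_lt => y.
  move=> [y M] [/= [bsy lty] sM]; exists s; split=> //.
  exact/hnorm_ltE.
exists M => x /(MP M (leqnn M))[s [sM bs lt_eps]].
exists (fun i => (nth (0, x) s i).2), (fun i => (nth (0, x) s i).1); split.
  (* Past the end of [s], the default [(0, x)] gives weight zero and center [x], which lies in its
     own ball. *)
  move=> i; have [i_s|s_i] := ltnP i (size s); first by apply/bs/mem_nth.
  by rewrite nth_default//=; apply: ballxx.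
by under eq_fun do rewrite -(kcomb_pad K x _ sM).
Qed.
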